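(* Let $r,n$ be integers with $2\le r\le n-3$. Let $\mathcal M_r=\mathrm{RM}(r,n)$ be the Reed-Muller code of length $2^n$, with generating monomial set $M_r$, the set of all monomials in $x_0,\dots,x_{n-1}$ of degree at most $r$. Let $\mathcal P_r$ be the polar code of length $2^n$ with generating monomial set $P_r=M_r\cup\{x_0x_1\cdots x_r\}$. Then the full automorphism group $\mathrm{Aut}\,\mathcal P_r$ is a subgroup of $\mathrm{Aut}\,\mathcal M_r$, and thus affine (every automorphism of $\mathcal P_r$ is affine). In particular, with $m=r+1$, $$\mathrm{Aut}\,\mathcal P_r\cong(\mathbb Z_2)^{(n-m)(m+1)}:\bigl(\mathrm{AGL}(m,2)\times\mathrm{GL}(n-m,2)\bigr).$$
   Context: Monomials and evaluation. A monomial in $x_0,\dots,x_{n-1}$ is a squarefree product $x_0^{v_0}\cdots x_{n-1}^{v_{n-1}}$, $v\in\mathbb F_2^n$, of degree the Hamming weight of $v$; the degree $0$ monomial is $\mathbf 1$. A monomial is identified with its evaluation vector in $\mathbb F_2^{2^n}$: $\mathbf 1$ is the all-ones vector, $x_i$ is the vector whose entry in position $j\in\{0,\dots,2^n-1\}$ is $1$ if and only if the $i$-th binary digit of $j$ ($i=0$ least significant) is $0$, and products of monomials are entrywise products. A monomial code of length $2^n$ is the $\mathbb F_2$-span of the evaluation vectors of a set of monomials, called its generating monomial set. The code $\mathcal P_r$ is simply the monomial code of length $2^n$ generated by $P_r$. Automorphisms. $\mathrm S_N$ is the symmetric group of degree $N$; it acts on $\mathbb F_2^N$ by permuting coordinates.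 An automorphism of a code $\mathcal C\subseteq\mathbb F_2^N$ is a permutation $\tau\in\mathrm S_N$ with $\tau(c)\in\mathcal C$ for all $c\in\mathcal C$; $\mathrm{Aut}\,\mathcal C$ is the group of all automorphisms. For $N=2^n$, identify coordinate positions with points of $\mathbb F_2^n$ via the values of $(x_0,\dots,x_{n-1})$ there; a permutation of the positions is affine if it has the form $x\mapsto Ax+b$ with $A$ an invertible $n\times n$ binary matrix and $b\in\mathbb F_2^n$. $\mathrm{AGL}(m,2)$ is the group of all invertible affine maps of $\mathbb F_2^m$. The notation $A:B$ denotes a semidirect product (split extension) with normal subgroup $A$ and complement $B$. *)

(* Defs.v *)
From HB Require Import structures.
From mathcomp Require Import all_boot all_order all_algebra all_fingroup all_solvable.

Set Implicit Arguments.
Unset Strict Implicit.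
Unset Printing Implicit Defensive.

Import GRing.Theory GroupScope.
Local Open Scope ring_scope.

(* The i-th variable is 1 exactly where the i-th binary digit vanishes. *)
Definition var_value (i j : nat) : 'F_2 := (~~ odd (j %/ 2 ^ i))%:R.

(* A squarefree monomial x^v is given by the support of its exponent v, so its
   degree is the cardinal of that support. *)
Definition monomial (n : nat) : predArgType := {set 'I_n}.

Definition degree (n : nat) (v : monomial n) : nat := #|v|.

Definition monomial_eval (n : nat) (v : monomial n) : 'rV['F_2]_(2 ^ n) :=
  \row_(j < 2 ^ n) \prod_(i in v) var_value i j.

Definition monomial_code (n : nat) (S : {set monomial n}) :
    {vspace 'rV['F_2]_(2 ^ n)} :=
  <<[seq monomial_eval v | v in S]>>%VS.

Definition reed_muller_monomials (r n : nat) : {set monomial n} :=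
  [set v : monomial n | degree v <= r]%N.

Definition polar_monomials (r n : nat) : {set monomial n} :=
  reed_muller_monomials r n :|: [set [set i : 'I_n | i <= r]%N].

Definition reed_muller_code (r n : nat) := monomial_code (reed_muller_monomials r n).

Definition polar_code (r n : nat) := monomial_code (polar_monomials r n).

(* [col_perm s c] has entry [c (s j)] in position j. Acting by s^-1 instead
   defines the same set of automorphisms, since 'S_N is finite. *)
Definition code_aut_set (N : nat) (C : {vspace 'rV['F_2]_N}) : {set 'S_N} :=
  [set s : 'S_N | [forall c in C, col_perm s c \in C]].

Lemma code_aut_group_set (N : nat) (C : {vspace 'rV['F_2]_N}) :
  group_set (code_aut_set C).
Proof.
apply/group_setP; split=> [|s t]; first by rewrite inE; apply/forall_inP=> c; rewrite col_perm1.
rewrite !inE => /forall_inP sC /forall_inP tC; apply/forall_inP=> c cC.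
by rewrite col_permM sC ?tC.
Qed.

Canonical code_aut (N : nat) (C : {vspace 'rV['F_2]_N}) : {group 'S_N} :=
  Group (code_aut_group_set C).

(* The point of F_2^n identified with position j. *)
Definition position_point (n : nat) (j : 'I_(2 ^ n)) : 'cV['F_2]_n :=
  \col_(i < n) var_value i j.

Definition affine_position_perm (n : nat) (s : 'S_(2 ^ n)) : Prop :=
  exists A : 'M['F_2]_n, exists b : 'cV['F_2]_n,
    A \in unitmx /\
    forall j, position_point (s j) = A *m position_point j + b.

Definition AGL_set (m : nat) : {set {perm 'cV['F_2]_m}} :=
  [set s : {perm 'cV['F_2]_m} |
    [exists A : 'M['F_2]_m, exists b : 'cV['F_2]_m,
      (A \in unitmx) && [forall x, s x == A *m x + b]]].

Lemma AGL_group_set (m : nat) : group_set (AGL_set m).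
Proof.
apply/group_setP; split=> [|s t]; rewrite !inE.
  apply/existsP; exists 1%:M; apply/existsP; exists 0; rewrite unitmx1 /=.
  by apply/forallP=> x; rewrite perm1 mul1mx addr0.
case/existsP=> A /existsP[b /andP[uA /forallP sE]].
case/existsP=> B /existsP[c /andP[uB /forallP tE]].
apply/existsP; exists (B *m A); apply/existsP; exists (B *m b + c).
rewrite unitmx_mul uA uB /=; apply/forallP=> x.
by rewrite permM (eqP (tE _)) (eqP (sE _)) mulmxDr mulmxA addrA.
Qed.

Canonical AGL (m : nat) : {group {perm 'cV['F_2]_m}} := Group (AGL_group_set m).

(* G ~= A : B, where, as in this notation, the action of B on A is left
   unspecified. *)
Definition isog_split_extension (gT aT bT : finGroupType)
    (G : {group gT}) (A : {group aT}) (B : {group bT}) : Prop :=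
  exists N : {group gT}, exists K : {group gT},
    [/\ N ><| K = G, N \isog A & K \isog B]%g.

(* Main.v *)
Require Import Defs.
From HB Require Import structures.
From mathcomp Require Import all_boot all_order all_algebra all_fingroup all_solvable.

Set Implicit Arguments.
Unset Strict Implicit.
Unset Printing Implicit Defensive.

Import GRing.Theory GroupScope.
Local Open Scope ring_scope.

(** Write m = r + 1, call x_0, ..., x_r the leading variables, and let V be the
    space of directions along which they are all constant.

    Affinity. The minimum weight words of the dual code determine the affine
    geometry. A set S of size 2^m that is annihilated by all monomials of degree
    at most r is an affine flat, by induction on the degree through hyperplane
    sections ([annihilated_flat]). So the dual words of weight 2^m, whose supports
    are called dual blocks, are flats; they are those flats of size 2^m that have
    a nonzero direction in common with V ([flat_dual_block],
    [dual_block_agree]), since the leading monomial has sum 1 on a complement of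
    V. An automorphism permutes the dual blocks. As dim V >= 2, 3 <= m and m < n,
    every plane is the intersection of the dual blocks that contain it, so an
    automorphism maps planes to planes and preserves the relation x + y + z = w
    ([polar_aut_sum3]); over F_2 this makes it affine. Affine permutations do not
    raise degrees, so they preserve the Reed-Muller code.

    Structure. The linear part of an automorphism preserves V: if a direction of V
    were moved out of V, a complement of V through its image would have a dual
    block as preimage and so be a dual block itself ([polar_aut_hidden]).
    Conversely, an affine permutation whose linear part preserves V maps the
    leading monomial to a polynomial in the leading variables, which lies in the
    code ([affine_polar_aut]). In coordinates (x_1, x_2) with m leading and n - m
    other entries, the automorphisms are therefore the maps
      (x_1, x_2) |-> (P x_1 + p, Q x_1 + R x_2 + q)
    with P and R invertible. Those with P = 1, p = 0, R = 1 form an elementary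
    abelian normal subgroup, with the (n - m) (m + 1) entries of Q and q as
    coordinates, and those with Q = 0, q = 0 form a complement isomorphic to
    AGL(m, 2) x GL(n - m, 2). *)

(** * Arithmetic over the two-element field *)

Lemma F2_cases (a : 'F_2) : a = 0 \/ a = 1.
Proof. by case: a => [[|[|k]] //= lt_k2]; [left | right]; apply: val_inj. Qed.

(** Proves an identity between sums of matrix variables over F_2 by trying all
    entry values. *)
Ltac char2 := apply/matrixP => ? ?; rewrite !mxE;
  repeat match goal with |- context [fun_of_matrix ?x ?i ?j] =>
    case: (F2_cases (fun_of_matrix x i j)) => -> end; exact: val_inj.

Lemma addrr2 m n (x : 'M['F_2]_(m, n)) : x + x = 0.
Proof. char2. Qed.

Lemma addrK2 m n (x y : 'M['F_2]_(m, n)) : x + y + y = x.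
Proof. char2. Qed.

Lemma addr2_eq0 m n (x y : 'M['F_2]_(m, n)) : (x + y == 0) = (x == y).
Proof.
apply/eqP/eqP => [xy0|->]; last exact: addrr2.
by rewrite -[x](addrK2 x y) xy0 add0r.
Qed.

(** The four inequalities say that [w] is outside the row space of [u^T] and
    [v^T]; a column of the cokernel of that space then gives the functional. *)
Lemma separating_functional n (u v w : 'cV['F_2]_n) :
  w != 0 -> w != u -> w != v -> w != u + v ->
  exists l : 'rV['F_2]_n, [/\ l *m u = 0, l *m v = 0 & l *m w = 1%:M].
Proof.
move=> w0 wu wv wuv; set B := col_mx u^T v^T.
have wB : ~~ (w^T <= B)%MS.
  apply/negP => /submxP[D]; rewrite -[D]hsubmxK mul_row_col.
  rewrite [lsubmx D]mx11_scalar [rsubmx D]mx11_scalar !mul_scalar_mx.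
  move/(congr1 trmx); rewrite linearD !linearZ /= !trmxK => wE.
  move: w0 wu wv wuv; rewrite wE.
  by case: (F2_cases (lsubmx D 0 0)) => ->; case: (F2_cases (rsubmx D 0 0)) => ->;
    rewrite ?scale0r ?scale1r ?add0r ?addr0 eqxx.
move: wB; rewrite submxE => /matrix0Pn[i [j nz]].
exists (col j (cokermx B))^T.
have BK : B *m cokermx B = 0 by rewrite mulmx_coker.
move: BK; rewrite mul_col_mx => /eqP; rewrite col_mx_eq0 => /andP[/eqP uK /eqP vK].
have E (x : 'cV['F_2]_n) : (col j (cokermx B))^T *m x = (col j (x^T *m cokermx B))^T.
  by apply: trmx_inj; rewrite trmx_mul !trmxK !colE mulmxA.
rewrite !E uK vK; split; try by apply/matrixP => a b; rewrite !mxE.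
have w1 : (w^T *m cokermx B) 0 j = 1.
  by move: nz; rewrite ord1; case: (F2_cases ((w^T *m cokermx B) 0 j)) => ->; rewrite ?eqxx.
by apply/matrixP => a b; rewrite !ord1 [LHS]mxE [LHS]mxE w1 mxE.
Qed.

(** * Positions, points and words *)

Lemma digits_inj n j k : (j < 2 ^ n)%N -> (k < 2 ^ n)%N ->
  (forall i, (i < n)%N -> odd (j %/ 2 ^ i) = odd (k %/ 2 ^ i)) -> j = k.
Proof.
elim: n j k => [|n IHn] j k; first by rewrite expn0 !ltnS !leqn0 => /eqP-> /eqP->.
rewrite expnS => ltj ltk dig.
have := dig 0 isT; rewrite expn0 !divn1 => odd_jk.
rewrite -[j]odd_double_half -[k]odd_double_half odd_jk (IHn j./2 k./2) //.
- by rewrite -divn2 ltn_divLR // mulnC.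
- by rewrite -divn2 ltn_divLR // mulnC.
by move=> i lti; rewrite -!divn2 -!divnMA -expnS dig.
Qed.

Lemma position_point_inj n : injective (@position_point n).
Proof.
move=> j k /colP eq_jk; apply/val_inj/(digits_inj (ltn_ord j) (ltn_ord k)) => i lti.
have := eq_jk (Ordinal lti); rewrite !mxE /var_value /=.
by case: (odd _); case: (odd _).
Qed.

Lemma position_point_onto n (x : 'cV['F_2]_n) : x \in codom (@position_point n).
Proof.
apply: inj_card_onto; first exact: position_point_inj.
by rewrite card_mx !card_ord muln1.
Qed.

Definition point_position n (x : 'cV['F_2]_n) : 'I_(2 ^ n) :=
  iinv (position_point_onto x).

Lemma point_positionK n : cancel (@point_position n) (@position_point n).
Proof. by move=> x; rewrite /point_position f_iinv. Qed.

Lemma position_pointK n : cancel (@position_point n) (@point_position n).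
Proof. by move=> j; apply: position_point_inj; rewrite point_positionK. Qed.

(** Codewords are handled as functions on points, so that composition with a
    point permutation becomes the coordinate action. *)
Definition word n (f : 'cV['F_2]_n -> 'F_2) : 'rV['F_2]_(2 ^ n) :=
  \row_j f (position_point j).

Definition mono n (v : monomial n) (x : 'cV['F_2]_n) : 'F_2 :=
  \prod_(i in v) x i 0.

Lemma word_mono n (v : monomial n) : word (mono v) = monomial_eval v.
Proof.
by apply/rowP => j; rewrite !mxE; apply: eq_bigr => i _; rewrite mxE.
Qed.

Lemma eq_word n (f g : 'cV['F_2]_n -> 'F_2) : f =1 g -> word f = word g.
Proof. by move=> fg; apply/rowP => j; rewrite !mxE fg. Qed.

Lemma wordD n (f g : 'cV['F_2]_n -> 'F_2) :
  word (fun x => f x + g x) = word f + word g.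
Proof. by apply/rowP => j; rewrite !mxE. Qed.

(** * Monomial codes *)

Section MonomialCode.
Variable n : nat.
Implicit Types (M : {set monomial n}) (v : monomial n) (f g : 'cV['F_2]_n -> 'F_2).

Lemma mem_monomial_code M v : v \in M -> word (mono v) \in monomial_code M.
Proof. by move=> vM; rewrite word_mono; apply: memv_span; apply: image_f. Qed.

(** As scalars are 0 or 1, a span over F_2 is reached by adding generators. *)
Lemma monomial_code_ind M (P : 'rV['F_2]_(2 ^ n) -> Prop) :
    P 0 -> (forall v c, v \in M -> P c -> P (monomial_eval v + c)) ->
  forall c, c \in monomial_code M -> P c.
Proof.
move=> P0 PD c; rewrite /monomial_code; set X := [seq _ | _ in _] => cX.
rewrite (coord_span (X := in_tuple X) cX).
apply: (big_rec P) => // i d _ Pd.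
case: (F2_cases (coord (in_tuple X) i c)) => ->; first by rewrite scale0r add0r.
by rewrite scale1r; have /imageP[v vM ->] := mem_nth 0 (ltn_ord i); apply: PD.
Qed.

Lemma monomial_codeS M M' : M \subset M' ->
  (monomial_code M <= monomial_code M')%VS.
Proof.
move=> sMM'; apply/span_subvP => c /imageP[v vM ->].
by rewrite -word_mono mem_monomial_code // (subsetP sMM').
Qed.

(** Over F_2 variables are idempotent, so monomials multiply by union. *)
Lemma monoM v v' (x : 'cV['F_2]_n) : mono v x * mono v' x = mono (v :|: v') x.
Proof.
rewrite /mono !(big_mkcond (fun i => i \in _)) -big_split; apply: eq_bigr => i _.
rewrite inE /=; case: (i \in v); case: (i \in v'); rewrite /= ?mulr1 ?mul1r //.
by case: (F2_cases (x i 0)) => ->; rewrite ?mulr0 ?mulr1.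
Qed.

Lemma monomial_codeM M M' M'' f g :
    (forall v v', v \in M -> v' \in M' -> v :|: v' \in M'') ->
    word f \in monomial_code M -> word g \in monomial_code M' ->
  word (fun x => f x * g x) \in monomial_code M''.
Proof.
move=> MM'' fM gM'.
have prodM c d : c \in monomial_code M -> d \in monomial_code M' ->
    \row_j (c 0 j * d 0 j) \in monomial_code M''.
  move=> cM dM'; elim/monomial_code_ind: c / cM => [|v c vM IHc].
    rewrite (_ : \row_j _ = 0) ?mem0v //.
    by apply/rowP => j; rewrite !mxE mul0r.
  rewrite (_ : \row_j _ = \row_j (monomial_eval v 0 j * d 0 j)
                          + \row_j (c 0 j * d 0 j)); last first.
    by apply/rowP => j; rewrite !mxE mulrDl.
  apply: memvD => //; elim/monomial_code_ind: d / {IHc c} dM' => [|v' d vM' IHd].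
    rewrite (_ : \row_j _ = 0) ?mem0v //.
    by apply/rowP => j; rewrite !mxE mulr0.
  rewrite (_ : \row_j _ = monomial_eval (v :|: v')
                 + \row_j (monomial_eval v 0 j * d 0 j)); last first.
    rewrite -!word_mono; apply/rowP => j; rewrite !mxE mulrDr.
    by rewrite monoM.
  by rewrite memvD // -word_mono mem_monomial_code // MM''.
have -> : word (fun x => f x * g x) = \row_j (word f 0 j * word g 0 j).
  by apply/rowP => j; rewrite !mxE.
exact: prodM.
Qed.

(** An affine function lies in every code whose monomials include the constant
    and the variables that it involves. *)
Lemma affine_in_code M (l : 'rV['F_2]_n) (a : 'F_2) :
    set0 \in M -> (forall i, l 0 i != 0 -> [set i] \in M) ->
  word (fun x => (l *m x) 0 0 + a) \in monomial_code M.
Proof.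
move=> M0 Ml; rewrite wordD memvD //.
  rewrite (_ : word _ = \sum_i l 0 i *: word (mono [set i])); last first.
    apply/rowP => j; rewrite summxE !mxE; apply: eq_bigr => i _.
    by rewrite !mxE /mono big_set1 mxE.
  apply: memv_suml => i _; have [->|nz] := eqVneq (l 0 i) 0.
    by rewrite scale0r mem0v.
  by rewrite memvZ // mem_monomial_code // Ml.
rewrite (_ : word _ = a *: word (mono set0)); last first.
  by apply/rowP => j; rewrite !mxE /mono big_set0 mulr1.
by rewrite memvZ // mem_monomial_code.
Qed.

Lemma sum_code_eq0 M (S : {set 'cV['F_2]_n}) f :
    (forall v, v \in M -> \sum_(x in S) mono v x = 0) ->
  word f \in monomial_code M -> \sum_(x in S) f x = 0.
Proof.
move=> S0 fM.
have sum0 c : c \in monomial_code M -> \sum_(x in S) c 0 (point_position x) = 0.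
  move=> cM; elim/monomial_code_ind: c / cM => [|v c vM IHc].
    by rewrite big1 // => x _; rewrite mxE.
  transitivity (\sum_(x in S) (mono v x + c 0 (point_position x))); last first.
    by rewrite big_split /= S0 // IHc addr0.
  by apply: eq_bigr => x _; rewrite mxE -word_mono mxE point_positionK.
rewrite -[RHS](sum0 _ fM); apply: eq_bigr => x _.
by rewrite mxE point_positionK.
Qed.

End MonomialCode.

(** * Sets of points annihilated by all monomials of small degree *)

(** Over F_2 a nonempty set is an affine subspace exactly when it is closed under
    sums of three elements; no base point or direction space is needed. *)
Definition flat n (S : {set 'cV['F_2]_n}) : Prop :=
  forall x y z, x \in S -> y \in S -> z \in S -> x + y + z \in S.

Definition annihilated n (k : nat) (S : {set 'cV['F_2]_n}) : Prop :=
  forall v : monomial n, (#|v| < k)%N -> \sum_(x in S) mono v x = 0.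

Definition hyperplane_section n (S : {set 'cV['F_2]_n}) (l : 'rV['F_2]_n) (a : 'F_2) :=
  [set x in S | (l *m x) 0 0 == a].

(** The indicator of a hyperplane is an affine function, which costs one degree. *)
Lemma annihilated_hyperplane_section n k (S : {set 'cV['F_2]_n}) l a :
  annihilated k.+1 S -> annihilated k (hyperplane_section S l a).
Proof.
move=> annS v ltvk.
transitivity (\sum_(x in S) (mono v x * ((l *m x) 0 0 + (a + 1)))).
  rewrite big_mkcond [RHS]big_mkcond; apply: eq_bigr => x _.
  rewrite inE; case: (x \in S) => //=.
  have two0 : 1 + 1 = 0 :> 'F_2 by apply: val_inj.
  case: (F2_cases ((l *m x) 0 0)) => ->; case: (F2_cases a) => ->;
    by rewrite ?eqxx ?add0r ?two0 ?addr0 ?two0 ?mulr1 ?mulr0.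
apply: (@sum_code_eq0 _ [set v' : monomial n | #|v'| < k.+1]%N) => [v'|].
  by rewrite inE => /annS.
apply: (@monomial_codeM _ [set v] [set v' : monomial n | #|v'| <= 1]%N).
- move=> _ w /set1P-> ; rewrite !inE => w1.
  apply: leq_ltn_trans (leq_card_setU _ _) _.
  by apply: leq_ltn_trans (leq_add (leqnn _) w1) _; rewrite addn1.
- by apply: mem_monomial_code; rewrite set11.
by apply: affine_in_code => [|i _]; rewrite inE ?cards0 ?cards1.
Qed.

Lemma card_hyperplane_section n (S : {set 'cV['F_2]_n}) l a :
  #|S| = (#|hyperplane_section S l a| + #|hyperplane_section S l (a + 1)%R|)%N.
Proof.
rewrite -(cardsID [set x | (l *m x) 0 0 == a] S); congr (_ + _)%N.
  by apply: eq_card => x; rewrite !inE.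
apply: eq_card => x; rewrite !inE andbC; congr (_ && _).
case: (F2_cases ((l *m x) 0 0)) => ->; by case: (F2_cases a) => ->.
Qed.

(** This is the description of the minimum weight words of a Reed-Muller code.
    A hyperplane through some but not all points of [S] cuts [S] into two sets
    annihilated one degree lower, whence the bound by induction; in the equality
    case both halves are flats, and three points of [S] lie in a common half
    unless [S] has no points outside the plane that they span. *)
Lemma annihilated_flat n k (S : {set 'cV['F_2]_n}) :
    S != set0 -> annihilated k S ->
  (2 ^ k <= #|S|)%N /\ (#|S| = (2 ^ k)%N -> flat S).
Proof.
elim: k S => [|k IHk] S S0 annS.
  rewrite expn0 card_gt0; split=> // /eqP/cards1P[a ->] x y z.
  by move=> /set1P-> /set1P-> /set1P->; rewrite addrr2 add0r set11.
(* The constant monomial has sum [#|S|] modulo 2. *)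
have evenS : ~~ odd #|S|.
  have := annS set0; rewrite cards0 => /(_ isT).
  rewrite (eq_bigr (fun=> 1)) => [|x _]; last by rewrite /mono big_set0.
  rewrite sumr_const; case: (odd #|S|) (odd_double_half #|S|) => // <-.
  rewrite mulrnDr -muln2 mulnC mulrnA (_ : 1 *+ 2 = 0 :> 'F_2) ?mul0rn //.
  exact: val_inj.
(* [l] takes different values at [x] and [y], so both sections are nonempty. *)
have half l x y : x \in S -> y \in S -> (l *m (y + x)) 0 0 = 1 ->
    let H := hyperplane_section S l ((l *m x) 0 0) in
    [/\ (2 ^ k.+1 <= #|S|)%N, x \in H & #|S| = (2 ^ k.+1)%N -> flat H].
  move=> xS yS; rewrite mulmxDr mxE => lxy H.
  have xH : x \in H by rewrite inE xS eqxx.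
  have yH : y \in hyperplane_section S l ((l *m x) 0 0 + 1).
    rewrite inE yS -lxy /=; apply/eqP.
    by case: (F2_cases ((l *m y) 0 0)) => ->; case: (F2_cases ((l *m x) 0 0)) => ->;
      apply: val_inj.
  have [||geH flatH] := IHk H; first by apply/set0Pn; exists x.
    exact: annihilated_hyperplane_section.
  have [||geH' _] := IHk (hyperplane_section S l ((l *m x) 0 0 + 1)).
  - by apply/set0Pn; exists y.
  - exact: annihilated_hyperplane_section.
  have cS := card_hyperplane_section S l ((l *m x) 0 0).
  split=> // [|cardS]; first by rewrite cS expnS mul2n -addnn leq_add.
  apply: flatH; apply/eqP; rewrite eqn_leq geH andbT.
  by rewrite -(leq_add2r (2 ^ k)) addnn -mul2n -expnS -cardS cS leq_add2l.
have [x xS] := set0Pn _ S0.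
split=> [|cardS {x xS} x y z xS yS zS].
  have /set0Pn[y /setD1P[yx yS]] : S :\ x != set0.
    apply: contra evenS => /eqP Sx0; have := cardsD1 x S.
    by rewrite xS Sx0 cards0 => ->.
  have yx0 : y + x != 0 by rewrite addr2_eq0.
  have [||||l [_ _ lyx]] := @separating_functional n 0 0 (y + x); rewrite ?addr0 //.
  by have [|//] := half l x y xS yS; rewrite lyx mxE eqxx.
have [->|yx] := eqVneq y x; first by rewrite addrr2 add0r.
have [->|zx] := eqVneq z x; first by rewrite addrAC addrr2 add0r.
have [->|zy] := eqVneq z y; first by rewrite addrK2.
have [w /andP[/= wS wN]|noW] := pickP [pred w in S | w \notin [set x; y; z; x + y + z]].
  move: wN; rewrite !inE !negb_or -!andbA => /and4P[wx wy wz wxyz].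
  have [||||l [ly lz lw]] := @separating_functional n (y + x) (z + x) (w + x).
  - by rewrite addr2_eq0.
  - by apply: contra wy => /eqP/(congr1 (+%R^~ x)); rewrite !addrK2 => ->.
  - by apply: contra wz => /eqP/(congr1 (+%R^~ x)); rewrite !addrK2 => ->.
  - apply: contra wxyz => /eqP/(congr1 (+%R^~ x)); rewrite addrK2 => ->.
    by apply/eqP; char2.
  have [|_ xH flatH] := half l x w xS wS; first by rewrite lw mxE eqxx.
  have inH y' : y' \in S -> l *m (y' + x) = 0 -> y' \in hyperplane_section S l ((l *m x) 0 0).
    move=> y'S; rewrite inE y'S mulmxDr => /eqP; rewrite addr2_eq0 => /eqP-> /=.
    by rewrite eqxx.
  by have := flatH cardS x y z xH (inH y yS ly) (inH z zS lz); rewrite inE => /andP[].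
(* No fourth point: a set of three elements would have odd size. *)
apply: contraR evenS => wS.
rewrite (_ : S = [set x; y; z]).
  by rewrite -setUA cardsU1 !inE cards2 negb_or eq_sym yx eq_sym zx eq_sym zy.
apply/setP => w; rewrite !inE; apply/idP/idP => [wS'|].
  have := noW w; rewrite !inE wS' /= => /negbFE; case: (w =P _ + _) => [E|_].
    by rewrite -E wS' in wS.
  by rewrite orbF.
by case/orP => [/orP[]|] /eqP->.
Qed.

(** * Building flats *)

(** When [F] is flat, this is the flat spanned by [F] and its translate by [e]. *)
Definition adjoin n (F : {set 'cV['F_2]_n}) (e : 'cV['F_2]_n) :=
  [set x | (x \in F) || (x + e \in F)].

Lemma sub_adjoin n (F : {set 'cV['F_2]_n}) e : F \subset adjoin F e.
Proof. by apply/subsetP => x xF; rewrite inE xF. Qed.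

Lemma adjoin_flat n (F : {set 'cV['F_2]_n}) e : flat F -> flat (adjoin F e).
Proof.
move=> flatF x y z; rewrite !inE => /orP[]xF /orP[]yF /orP[]zF;
  have := flatF _ _ _ xF yF zF.
- by move->.
- by rewrite !addrA => ->; rewrite orbT.
- by rewrite (_ : _ + z = x + y + z + e) => [->|]; [rewrite orbT | char2].
- by rewrite (_ : _ + (z + e) = x + y + z) => [->|] //; char2.
- by rewrite (_ : _ + z = x + y + z + e) => [->|]; [rewrite orbT | char2].
- by rewrite (_ : _ + (z + e) = x + y + z) => [->|] //; char2.
- by rewrite (_ : _ + z = x + y + z) => [->|] //; char2.
by rewrite (_ : _ + (z + e) = x + y + z + e) => [->|]; [rewrite orbT | char2].
Qed.

Lemma card_adjoin n (F : {set 'cV['F_2]_n}) a e :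
  flat F -> a \in F -> a + e \notin F -> #|adjoin F e| = (2 * #|F|)%N.
Proof.
move=> flatF aF aeF.
have -> : adjoin F e = F :|: [set x + e | x in F].
  apply/setP => x; rewrite !inE; congr (_ || _).
  apply/idP/imsetP => [xeF|[y yF ->]]; last by rewrite addrK2.
  by exists (x + e); rewrite ?addrK2.
rewrite cardsU disjoint_setI0 ?cards0 ?subn0.
  by rewrite card_imset ?mul2n ?addnn //; apply: addIr.
apply/pred0P => x /=; apply/andP => -[xF /imsetP[y yF xE]].
have := flatF _ _ _ aF xF yF; rewrite xE (_ : _ + y = a + e) ?(negPf aeF) //.
char2.
Qed.

(** Directions are adjoined one at a time: as long as the flat is too small, some
    direction leads neither back into it nor to a forbidden point. *)
Lemma flat_extend n k d (F Q : {set 'cV['F_2]_n}) :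
    flat F -> #|F| = (2 ^ k)%N -> [disjoint F & Q] ->
    (#|Q|.+1 * 2 ^ (k + d) < 2 ^ n.+1)%N ->
  exists F' : {set 'cV['F_2]_n},
    [/\ F \subset F', flat F', #|F'| = (2 ^ (k + d))%N & [disjoint F' & Q]].
Proof.
elim: d k F => [|d IHd] k F flatF cardF disFQ; first by rewrite addn0; exists F.
rewrite addnS -addSn => small.
have /set0Pn[a aF] : F != set0 by rewrite -card_gt0 cardF expn_gt0.
(* [E] collects the directions to avoid: since [F] is flat, the differences of its
   points are exactly the [a + x]. *)
pose E := [set q + x | q in a |: Q, x in F].
have cardE : (#|E| <= #|Q|.+1 * 2 ^ k)%N.
  rewrite /E curry_imset2X; apply: leq_trans (leq_imset_card _ _) _.
  rewrite cardsX cardF leq_mul // cardsU1.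
  by case: (a \notin Q); rewrite ?add0n ?add1n ?leqnSn.
have /subsetPn[e _ eE] : ~~ ([set: 'cV['F_2]_n] \subset E).
  apply: contraL small => /subset_leq_card; rewrite cardsT card_mx card_ord muln1.
  rewrite -leqNgt (@addSnnS k) addnS !expnS !(mulnCA _ 2) leq_mul2l /= => /leq_trans; apply.
  by apply: leq_trans cardE _; rewrite leq_mul2l leq_pexp2l ?leq_addr ?orbT.
have notE q x : q \in a |: Q -> x \in F -> e != q + x.
  by move=> qQ xF; apply: contraNneq eE => ->; apply: imset2_f.
have aeF : a + e \notin F.
  apply/negP => aeF; have := notE a (a + e) (setU11 _ _) aeF.
  by rewrite addrA addrr2 add0r eqxx.
have [||||F' [sF' flatF' cardF' disF']] := IHd k.+1 (adjoin F e).
- exact: adjoin_flat.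
- by rewrite (card_adjoin flatF aF aeF) cardF expnS.
- apply/pred0P => q /=; apply/andP => -[]; rewrite inE => /orP[qF|qeF] qQ.
    by move/pred0P: disFQ => /(_ q); rewrite /= qF qQ.
  have := notE q (q + e); rewrite addrA addrr2 add0r eqxx => /(_ _ qeF).
  by rewrite inE qQ orbT => /(_ isT).
- exact: small.
by exists F'; split=> //; apply: subset_trans sF'; apply: sub_adjoin.
Qed.

(** * The blocks of the dual code *)

Definition leading_support (r n : nat) : monomial n := [set i : 'I_n | i <= r]%N.

Definition agree n (v : monomial n) (x y : 'cV['F_2]_n) :=
  forall i, i \in v -> x i 0 = y i 0.

(** The supports of the dual words of weight [2 ^ r.+1]; by [annihilated_flat] no
    nonzero word of the dual code is lighter. *)
Definition dual_block (r n : nat) (S : {set 'cV['F_2]_n}) : Prop :=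
  #|S| = (2 ^ r.+1)%N /\
  forall v, v \in polar_monomials r n -> \sum_(x in S) mono v x = 0.

Lemma card_leading_support r n : (r < n)%N -> #|leading_support r n| = r.+1.
Proof.
move=> ltrn; rewrite (_ : leading_support r n = [set widen_ord ltrn i | i : 'I_r.+1]).
  by rewrite card_imset ?card_ord // => i j /(congr1 val) /= /val_inj.
apply/setP => i; rewrite inE; apply/idP/imsetP => [ler|[j _ ->]]; last exact: ltn_ord j.
by exists (Ordinal (ler : (i < r.+1)%N)) => //; apply: val_inj.
Qed.

Lemma in_polar_monomials r n v :
  (v \in polar_monomials r n) = (#|v| <= r)%N || (v == leading_support r n).
Proof. by rewrite !inE. Qed.

(** The code contains all monomials of degree at most [r], so a dual block has the
    least possible size for a set that these annihilate. *)
Lemma dual_block_flat r n (S : {set 'cV['F_2]_n}) : dual_block r S -> flat S.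
Proof.
case=> cardS S0; have [||_] := @annihilated_flat n r.+1 S; last exact.
  by rewrite -card_gt0 cardS expn_gt0.
by move=> v ltv; apply: S0; rewrite in_polar_monomials -ltnS ltv.
Qed.

(** Translation by [e] pairs the points with equal values; a coordinate at which
    [e] is nonzero tells the two members of each pair apart. *)
Lemma sum_translation_eq0 n (S : {set 'cV['F_2]_n}) e (f : 'cV['F_2]_n -> 'F_2) :
    e != 0 -> (forall x, x \in S -> x + e \in S) -> (forall x, f (x + e) = f x) ->
  \sum_(x in S) f x = 0.
Proof.
move=> /matrix0Pn[i [j]]; rewrite ord1 => ei0 Se fe.
have {}ei0 : e i 0 = 1 by case: (F2_cases (e i 0)) ei0 => -> //; rewrite eqxx.
rewrite (bigID (fun x : 'cV_n => x i 0 == 0)) /=.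
rewrite [X in _ + X](reindex_inj (addIr e)) /=.
rewrite [X in _ + X](eq_big (fun x => (x \in S) && (x i 0 == 0)) f) //.
  by case: (F2_cases (\sum_(x in S | x i 0 == 0) f x)) => ->; apply: val_inj.
move=> x; rewrite mxE ei0; congr (_ && _).
  by apply/idP/idP => /Se; rewrite ?addrK2.
by case: (F2_cases (x i 0)) => ->.
Qed.

(** The values of the variables of [v] at [x], recorded as a set so that they can
    be counted by [powerset]. *)
Definition trace n (v : monomial n) (x : 'cV['F_2]_n) : monomial n :=
  [set i in v | x i 0 != 0].

Lemma trace_agree n (v : monomial n) x y : trace v x = trace v y -> agree v x y.
Proof.
move=> /setP eq_xy i iv; have := eq_xy i; rewrite !inE iv /=.
by case: (F2_cases (x i 0)) => ->; case: (F2_cases (y i 0)) => ->.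
Qed.

Lemma trace_sub n (v : monomial n) (S : {set 'cV['F_2]_n}) :
  trace v @: S \subset powerset v.
Proof.
by apply/subsetP => _ /imsetP[x _ ->]; rewrite inE; apply/subsetP => i /[!inE] /andP[].
Qed.

Lemma flat_sum_mono n (S : {set 'cV['F_2]_n}) (v : monomial n) x y :
    flat S -> x \in S -> y \in S -> x != y -> agree v x y ->
  \sum_(z in S) mono v z = 0.
Proof.
move=> flatS xS yS xy agr; apply: (@sum_translation_eq0 _ _ (x + y)).
- by rewrite addr2_eq0.
- by move=> z zS; rewrite addrA; apply: flatS.
move=> z; apply: eq_bigr => i iv; rewrite !mxE (agr i iv).
by case: (F2_cases (z i 0)) => ->; case: (F2_cases (y i 0)) => ->; apply: val_inj.
Qed.

(** The at most [r] variables of a monomial of degree at most [r] take at most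
    [2 ^ r] tuples of values, so two points of [S] agree on them, and translation by
    their difference preserves both [S] and the monomial. For the leading monomial,
    [x] and [y] are such points. *)
Lemma flat_dual_block r n (S : {set 'cV['F_2]_n}) x y :
    flat S -> #|S| = (2 ^ r.+1)%N ->
    x \in S -> y \in S -> x != y -> agree (leading_support r n) x y ->
  dual_block r S.
Proof.
move=> flatS cardS xS yS xy agr; split=> // v.
rewrite in_polar_monomials => /orP[lev|/eqP->]; last exact: flat_sum_mono agr.
have /dinjectivePn[x' x'S [y' /andP[/= y'x' y'S] eq_tr]] : ~~ dinjectiveb (trace v) S.
  apply/negP => /dinjectiveP/card_in_imset cardT.
  have := subset_leq_card (trace_sub v S); rewrite cardT cardS card_powerset.
  by rewrite leq_exp2l // ltnNge lev.
apply: flat_sum_mono flatS x'S y'S _ (trace_agree eq_tr).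
by rewrite eq_sym.
Qed.

(** Conversely, a dual block contains a hidden direction: if the traces on the
    leading variables were distinct, they would take every value once, and the
    leading monomial would have sum 1. *)
Lemma dual_block_agree r n (S : {set 'cV['F_2]_n}) :
    (r < n)%N -> dual_block r S ->
  exists x y, [/\ x \in S, y \in S, x != y & agree (leading_support r n) x y].
Proof.
move=> ltrn [cardS S0]; set J := leading_support r n.
have [/dinjectiveP inj|] := boolP (dinjectiveb (trace J) S); last first.
  case/dinjectivePn=> x xS [y /andP[/= yx yS] eq_tr].
  by exists x, y; split=> //; [rewrite eq_sym | apply: trace_agree].
have /setP/(_ J) : trace J @: S = powerset J.
  apply/eqP; rewrite eqEcard trace_sub (card_in_imset inj) cardS card_powerset.
  by rewrite card_leading_support ?leqnn.
rewrite inE subxx => /imsetP[x0 x0S trJ].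
have := S0 J; rewrite in_polar_monomials eqxx orbT => /(_ isT).
rewrite (bigD1 x0) //= big1 => [|x /andP[xS xx0]].
  rewrite /mono big1 ?addr0 // => i; rewrite trJ inE => /andP[_].
  by case: (F2_cases (x0 i 0)) => ->.
have /subsetPn[i iJ] : ~~ (J \subset trace J x).
  apply: contra xx0 => sJ; apply/eqP/inj => //; rewrite -trJ.
  by apply/eqP; rewrite eqEsubset sJ andbT; apply/subsetP => i /[!inE] /andP[].
rewrite inE iJ negbK => /eqP xi0.
by rewrite /mono (bigD1 i) //= xi0 mul0r.
Qed.

(** * Automorphisms as permutations of points *)

Section PositionPerm.
Variable n : nat.
Implicit Types (s : 'S_(2 ^ n)) (t : {perm 'cV['F_2]_n}).

Lemma position_perm_inj t :
  injective (fun j : 'I_(2 ^ n) => point_position (t (position_point j))).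
Proof.
move=> j k /(can_inj (@point_positionK n))/perm_inj; exact: position_point_inj.
Qed.

(** Transport of permutations along the identification of positions with points.
    It respects composition, so that groups of point permutations can be studied
    instead of subgroups of ['S_(2 ^ n)]. *)
Definition position_perm t : 'S_(2 ^ n) := perm (@position_perm_inj t).

Lemma point_perm_inj s :
  injective (fun x : 'cV['F_2]_n => position_point (s (point_position x))).
Proof.
move=> x y /position_point_inj/perm_inj; exact: can_inj (@point_positionK n) _ _.
Qed.

Definition point_perm s : {perm 'cV['F_2]_n} := perm (@point_perm_inj s).

Lemma position_permE t j :
  position_point (position_perm t j) = t (position_point j).
Proof. by rewrite permE point_positionK. Qed.

Lemma point_permK : cancel point_perm position_perm.
Proof.
move=> s; apply/permP => j; apply: position_point_inj.
by rewrite position_permE permE position_pointK.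
Qed.

Lemma position_permM : {in setT &, {morph position_perm : t u / (t * u)%g}}.
Proof.
move=> t u _ _; apply/permP => j; apply: position_point_inj.
by rewrite permM !position_permE permM.
Qed.

Canonical position_perm_morphism := Morphism position_permM.

Lemma injm_position_perm : 'injm position_perm_morphism.
Proof.
apply/injmP => t u _ _ /permP eq_tu; apply/permP => x.
by rewrite -(point_positionK x) -!position_permE eq_tu.
Qed.

Lemma word_position_perm t (f : 'cV['F_2]_n -> 'F_2) :
  col_perm (position_perm t) (word f) = word (f \o t).
Proof. by apply/rowP => j; rewrite !mxE position_permE. Qed.

Lemma position_perm_aut (M : {set monomial n}) t :
    (forall v, v \in M -> word (mono v \o t) \in monomial_code M) ->
  position_perm t \in code_aut (monomial_code M).
Proof.
move=> Mt; rewrite inE; apply/forall_inP => c cM.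
elim/monomial_code_ind: c / cM => [|v c vM IHc]; first by rewrite linear0 mem0v.
by rewrite linearD memvD //= -word_mono word_position_perm Mt.
Qed.

Lemma code_aut_word (M : {set monomial n}) t f :
    position_perm t \in code_aut (monomial_code M) ->
  word f \in monomial_code M -> word (f \o t) \in monomial_code M.
Proof. by rewrite inE => /forall_inP tM /tM; rewrite word_position_perm. Qed.

End PositionPerm.

(** Automorphisms of a code are also automorphisms of its dual. *)
Lemma polar_aut_dual_block r n (t : {perm 'cV['F_2]_n}) S :
    position_perm t \in code_aut (polar_code r n) -> dual_block r S ->
  dual_block r (t @: S).
Proof.
move=> tP [cardS S0]; split=> [|v vP]; first by rewrite card_imset //; apply: perm_inj.
rewrite big_imset /=; last by move=> x y _ _; apply: perm_inj.
apply: sum_code_eq0 S0 _; apply: (code_aut_word (f := mono v)) tP _.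
exact: mem_monomial_code.
Qed.

Lemma two_hidden_directions r n : (r.+2 < n)%N ->
  exists v1 v2 : 'cV['F_2]_n, [/\ v1 != 0, v2 != 0, v1 != v2,
    agree (leading_support r n) v1 0 & agree (leading_support r n) v2 0].
Proof.
move=> ltrn; have lt1 := ltnW ltrn.
have hidden (i : 'I_n) : (r < i)%N ->
    agree (leading_support r n) (delta_mx i 0 : 'cV['F_2]_n) 0.
  move=> ri j; rewrite inE !mxE => jr; case: eqP => // E.
  by rewrite E leqNgt ri in jr.
have nz (i : 'I_n) : delta_mx i 0 != 0 :> 'cV['F_2]_n.
  by apply/matrix0Pn; exists i, 0; rewrite mxE !eqxx.
exists (delta_mx (Ordinal lt1) 0), (delta_mx (Ordinal ltrn) 0); split=> //.
- apply/eqP => /matrixP/(_ (Ordinal lt1) 0).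
  by rewrite !mxE !eqxx -val_eqE /= (ltn_eqF (ltnSn r.+1)).
- by apply: hidden.
by apply: hidden => /=.
Qed.

(** Four points summing to zero form the intersection of the dual blocks that
    contain them. Given a point [p] outside this plane, a direction along which
    the leading variables are constant is first added to the plane, unless it
    already contains one; two such directions are available, and they cannot
    both lead to [p]. The result still extends to a block that avoids [p]. *)
Lemma polar_aut_sum3 r n (t : {perm 'cV['F_2]_n}) :
    (2 <= r)%N -> (r.+2 < n)%N ->
    position_perm t \in code_aut (polar_code r n) ->
  forall x y z, t (x + y + z) = t x + t y + t z.
Proof.
move=> r2 rn tP x y z.
have [->|yx] := eqVneq y x; first by rewrite !addrr2 !add0r.
have [->|zx] := eqVneq z x; first by
  rewrite ![x + y + _]addrAC ![t x + t y + _]addrAC !addrr2 !add0r.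
have [->|zy] := eqVneq z y; first by rewrite !addrK2.
pose T1 := adjoin [set x] (x + y); pose T := adjoin T1 (x + z).
have flat1 : flat [set x].
  by move=> ? ? ? /set1P-> /set1P-> /set1P->; rewrite addrr2 add0r set11.
have flatT1 : flat T1 by apply: adjoin_flat.
have flatT : flat T by apply: adjoin_flat.
have xT1 : x \in T1 by rewrite !inE eqxx.
have xT : x \in T by rewrite inE xT1.
have yT : y \in T.
  by rewrite !inE (_ : y + (x + y) = x) ?eqxx ?orbT //; char2.
have zT : z \in T by rewrite inE (_ : z + (x + z) = x) ?xT1 ?orbT //; char2.
have cardT : #|T| = (2 ^ 2)%N.
  rewrite (@card_adjoin _ _ x) ?(@card_adjoin _ _ x) ?cards1 ?set11 //.
    by rewrite addrA addrr2 add0r inE.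
  rewrite addrA addrr2 add0r !inE (negPf zx) /=; apply: contra zy => /eqP E.
  by rewrite -addr2_eq0 (_ : z + y = z + (x + y) + x); [rewrite E addrr2 | char2].
(* [T] is the plane through [x], [y] and [z]; the point [p] has to be its fourth
   point, and the three others are excluded by injectivity. *)
pose p := (t^-1)%g (t x + t y + t z).
have tp : t p = t x + t y + t z by rewrite permKV.
have [pT|pT] := boolP (p \in T).
  have : [|| p == x, p == y, p == z | p == x + y + z].
    move: pT; rewrite !inE -!orbA => /or4P[]/eqP E; apply/or4P.
    - by constructor 1; apply/eqP.
    - by constructor 2; rewrite -(inj_eq (addIr (x + y))) E; apply/eqP; char2.
    - by constructor 3; rewrite -(inj_eq (addIr (x + z))) E; apply/eqP; char2.
    - constructor 4; rewrite -(inj_eq (addIr (x + z))) -(inj_eq (addIr (x + y))) E.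
      by apply/eqP; char2.
  case/or4P => /eqP E; move: tp; rewrite E // => tE.
  - case/eqP: zy; apply: (@perm_inj _ t); apply/eqP; rewrite -addr2_eq0.
    by rewrite (_ : _ + _ = t x + (t x + t y + t z)); [rewrite -tE addrr2 | char2].
  - case/eqP: zx; apply: (@perm_inj _ t); apply/eqP; rewrite -addr2_eq0.
    by rewrite (_ : _ + _ = t y + (t x + t y + t z)); [rewrite -tE addrr2 | char2].
  case/eqP: yx; apply: (@perm_inj _ t); apply/eqP; rewrite -addr2_eq0.
  by rewrite (_ : _ + _ = t z + (t x + t y + t z)); [rewrite -tE addrr2 | char2].
have [v1 [v2 [nz1 nz2 v12 ag1 ag2]]] := two_hidden_directions rn.
(* A flat of size at most 8 that contains [T] and a hidden direction, but not [p],
   would extend to a dual block that avoids [p]. *)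
have block (F : {set 'cV['F_2]_n}) k v :
    T \subset F -> flat F -> #|F| = (2 ^ k)%N -> (k <= 3)%N -> p \notin F ->
    v != 0 -> agree (leading_support r n) v 0 -> x + v \in F -> False.
  move=> sTF flatF cardF k3 pF nz agv xvF.
  have kr : (k <= r.+1)%N by apply: leq_trans k3 _.
  have [||F' [sF' flatF' cardF' disF']] :=
    @flat_extend n k (r.+1 - k) F [set p] flatF cardF.
  - by rewrite disjoint_sym disjoints1.
  - rewrite subnKC // cards1 -expnS ltn_exp2l // ltnS.
    exact: ltnW.
  have sTF' := subset_trans sTF sF'.
  have dF' : dual_block r F'.
    apply: (@flat_dual_block r n F' x (x + v)) => //.
    - by rewrite cardF' subnKC.
    - exact: (subsetP sTF').
    - exact: (subsetP sF').
    - by rewrite -addr2_eq0 addrA addrr2 add0r.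
    by move=> i iJ; rewrite mxE (agv i iJ) mxE addr0.
  have := dual_block_flat (polar_aut_dual_block tP dF').
  have im w : w \in T -> t w \in t @: F' by move=> wT; rewrite imset_f ?(subsetP sTF').
  move=> /(_ _ _ _ (im x xT) (im y yT) (im z zT)); rewrite -tp (mem_imset _ _ (@perm_inj _ t)).
  by move: disF'; rewrite disjoint_sym disjoints1 => /negPf->.
have inT v : v != 0 -> agree (leading_support r n) v 0 -> x + v \notin T.
  by move=> nz agv; apply/negP => /(block T 2 v); apply.
exfalso.
have outT v : v != 0 -> agree (leading_support r n) v 0 -> p + v \in T.
  move=> nz agv; apply: contraT => pvT; exfalso.
  apply: (block (adjoin T v) 3 v) => //.
  - exact: sub_adjoin.
  - exact: adjoin_flat.
  - by rewrite (card_adjoin flatT xT) ?cardT //; apply: inT.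
  - by rewrite inE negb_or pT.
  by rewrite inE addrK2 xT orbT.
have : x + (v1 + v2) \notin T.
  apply: inT; first by rewrite addr2_eq0.
  by move=> i iJ; rewrite mxE (ag1 i iJ) (ag2 i iJ) !mxE addr0.
have := flatT _ _ _ xT (outT v1 nz1 ag1) (outT v2 nz2 ag2).
by rewrite (_ : _ + (p + v2) = x + (v1 + v2)) => [->|] //; char2.
Qed.

(** * Affine permutations and the codes that they preserve *)

Lemma additive_mulmx n k (L : 'cV['F_2]_n -> 'cV['F_2]_k) :
  {morph L : x y / x + y} -> exists A : 'M_(k, n), forall x, L x = A *m x.
Proof.
move=> LD; have L0 : L 0 = 0 by apply: (addIr (L 0)); rewrite -LD !add0r.
have LZ a x : L (a *: x) = a *: L x.
  by case: (F2_cases a) => ->; rewrite ?scale0r ?scale1r.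
exists (\matrix_(i, j) L (delta_mx j 0) i 0) => x.
rewrite {1}[x]matrix_sum_delta (big_morph L LD L0).
apply/matrixP => i j; rewrite ord1 summxE mxE; apply: eq_bigr => l _.
by rewrite big_ord1 LZ !mxE mulrC.
Qed.

Lemma mulmx_inj_unit n (A : 'M['F_2]_n) :
  (forall x : 'cV_n, A *m x = 0 -> x = 0) -> A \in unitmx.
Proof.
move=> A0; rewrite -unitmx_tr -row_free_unit; apply: inj_row_free => v vA.
by apply: trmx_inj; rewrite trmx0; apply: A0; apply: trmx_inj;
  rewrite trmx_mul trmxK trmx0.
Qed.

(** Over F_2 additive maps are linear, as the only scalars are 0 and 1. *)
Lemma sum3_affine n (t : {perm 'cV['F_2]_n}) :
    (forall x y z, t (x + y + z) = t x + t y + t z) ->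
  exists A b, A \in unitmx /\ forall x, t x = A *m x + b.
Proof.
move=> t3; have [|A AE] := @additive_mulmx n n (fun x => t x + t 0).
  by move=> x y; rewrite -[x + y]addr0 t3; char2.
have tE x : t x = A *m x + t 0 by rewrite -AE addrK2.
exists A, (t 0); split=> //; apply: mulmx_inj_unit => x Ax0.
by apply: (@perm_inj _ t); rewrite tE Ax0 add0r.
Qed.

(** The family [M] grades the product: it is instantiated with the monomials of
    degree at most [k], and with a constant family closed under union. *)
Section ProductOfWords.
Variables (n : nat) (M1 : {set monomial n}) (M : nat -> {set monomial n}).
Hypotheses (M0 : set0 \in M 0%N)
  (MS : forall k v v', v \in M1 -> v' \in M k -> v :|: v' \in M k.+1).

Lemma word_prod (s : seq 'I_n) (f : 'I_n -> 'cV['F_2]_n -> 'F_2) :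
    {in s, forall i, word (f i) \in monomial_code M1} ->
  word (fun x => \prod_(i <- s) f i x) \in monomial_code (M (size s)).
Proof.
elim: s => [|i s IHs] sM /=.
  rewrite (_ : word _ = word (mono set0)) ?mem_monomial_code //.
  by apply: eq_word => x; rewrite big_nil /mono big_set0.
rewrite (_ : word _ = word (fun x => f i x * \prod_(j <- s) f j x)).
  apply: (monomial_codeM (@MS (size s))); first by apply: sM; rewrite mem_head.
  by apply: IHs => j js; apply: sM; rewrite inE js orbT.
by apply: eq_word => x; rewrite big_cons.
Qed.

End ProductOfWords.

Lemma word_mono_affine n (v : monomial n) (t : {perm 'cV['F_2]_n}) (A : 'M['F_2]_n)
    (b : 'cV['F_2]_n) :
    (forall x, t x = A *m x + b) ->
  word (mono v \o t)
    = word (fun x => \prod_(i <- enum v) ((row i A *m x) 0 0 + b i 0)).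
Proof.
move=> tE; apply: eq_word => x; rewrite /= /mono tE big_enum.
by apply: eq_bigr => i _; rewrite -row_mul !mxE.
Qed.

Lemma reed_muller_affine n r (t : {perm 'cV['F_2]_n}) (A : 'M['F_2]_n) (b : 'cV['F_2]_n)
    (v : monomial n) :
    (forall x, t x = A *m x + b) -> (#|v| <= r)%N ->
  word (mono v \o t) \in reed_muller_code r n.
Proof.
move=> tE lev; rewrite (word_mono_affine v tE).
have := @word_prod n (reed_muller_monomials 1 n) (reed_muller_monomials^~ n).
move=> /(_ _ _ (enum v) (fun i x => (row i A *m x) 0 0 + b i 0)) prod.
apply: subvP (monomial_codeS _) _ (prod _ _ _).
- by apply/subsetP => w; rewrite !inE -cardE => /leq_trans; apply.
- by rewrite inE /degree cards0.
- move=> k w w'; rewrite !inE => w1 w'k.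
  by apply: leq_trans (leq_card_setU _ _) _; rewrite -add1n leq_add.
by move=> i _; apply: affine_in_code => [|j _]; rewrite inE /degree ?cards0 ?cards1.
Qed.

Lemma affine_reed_muller_aut n r (t : {perm 'cV['F_2]_n}) (A : 'M['F_2]_n)
    (b : 'cV['F_2]_n) :
    (forall x, t x = A *m x + b) ->
  position_perm t \in code_aut (reed_muller_code r n).
Proof.
by move=> tE; apply: position_perm_aut => v; rewrite inE; apply: reed_muller_affine tE.
Qed.

(** When the leading coordinates of the image depend only on the leading
    coordinates of the argument, the image of the leading monomial is a
    polynomial in the leading variables, and all of these lie in the code. *)
Lemma affine_polar_aut n r (t : {perm 'cV['F_2]_n}) (A : 'M['F_2]_n)
    (b : 'cV['F_2]_n) :
    (r < n)%N -> (forall x, t x = A *m x + b) ->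
    (forall i j, i \in leading_support r n -> j \notin leading_support r n -> A i j = 0) ->
  position_perm t \in code_aut (polar_code r n).
Proof.
move=> ltrn tE A0; apply: position_perm_aut => v.
rewrite in_polar_monomials => /orP[lev|/eqP->].
  by apply: subvP (monomial_codeS (subsetUl _ _)) _ _; apply: reed_muller_affine tE lev.
set J := leading_support r n in A0 *; rewrite (word_mono_affine J tE).
have := @word_prod n (powerset J) (fun=> powerset J).
move=> /(_ _ _ (enum J) (fun i x => (row i A *m x) 0 0 + b i 0)) prod.
apply: subvP (monomial_codeS _) _ (prod _ _ _).
- apply/subsetP => w; rewrite in_polar_monomials inE => sw.
  have [//|ltw] := leqP; rewrite eqEcard sw /= card_leading_support //.
- by rewrite inE sub0set.
- by move=> k w w'; rewrite !inE subUset => -> ->.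
move=> i; rewrite mem_enum => iJ; apply: affine_in_code => [|j].
  by rewrite inE sub0set.
rewrite mxE inE sub1set; apply: contraNT => jJ.
by rewrite A0.
Qed.

(** The directions along which the leading variables are constant, and hence
    cannot detect. *)
Definition hidden_space r n : {set 'cV['F_2]_n} :=
  [set x : 'cV['F_2]_n | [forall i in leading_support r n, x i 0 == 0]].

Lemma hidden_spaceP r n (x : 'cV['F_2]_n) :
  reflect (agree (leading_support r n) x 0) (x \in hidden_space r n).
Proof.
rewrite inE; apply: (iffP forall_inP) => [x0 i /x0/eqP->|x0 i /x0->]; rewrite mxE //.
Qed.

(** A hidden vector is determined by its coordinates that are not leading. *)
Lemma card_hidden_space r n :
  (r < n)%N -> (#|hidden_space r n| * 2 ^ r.+1 <= 2 ^ n)%N.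
Proof.
move=> ltrn; set J := leading_support r n.
have -> : (2 ^ n = 2 ^ #|~: J| * 2 ^ r.+1)%N.
  by rewrite -expnD -(card_leading_support ltrn) addnC cardsC card_ord.
rewrite leq_mul2r -card_powerset.
have inj : {in hidden_space r n &, injective (trace (~: J))}.
  move=> x y /hidden_spaceP x0 /hidden_spaceP y0 /trace_agree eq_xy.
  apply/matrixP => i j; rewrite ord1; have [iJ|iJ] := boolP (i \in J).
    by rewrite x0 ?y0.
  by apply: eq_xy; rewrite inE.
by rewrite -(card_in_imset inj) subset_leq_card ?orbT // trace_sub.
Qed.

(** The linear part of an automorphism preserves the hidden space: otherwise some
    hidden direction [v] is moved to a direction [w] that is not hidden. A
    complement [F] of the hidden space through [w] is not a dual block, as the
    leading variables separate its points, but its preimage contains two points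
    that differ by [v] and is one. *)
Lemma polar_aut_hidden r n (t : {perm 'cV['F_2]_n}) (A : 'M['F_2]_n)
    (b : 'cV['F_2]_n) :
    (r < n)%N -> position_perm t \in code_aut (polar_code r n) ->
    (forall x, t x = A *m x + b) ->
  forall v, v \in hidden_space r n -> A *m v \in hidden_space r n.
Proof.
move=> ltrn tP tE v vV; set V := hidden_space r n; apply: contraT => wV; exfalso.
set w := A *m v in wV.
have zV : 0 \in V by apply/hidden_spaceP.
have nzw : w != 0 by apply: contraNneq wV => ->.
pose F0 := adjoin [set 0] w.
have flat0 : flat [set (0 : 'cV['F_2]_n)].
  by move=> ? ? ? /set1P-> /set1P-> /set1P->; rewrite !addr0 set11.
(* The complement is grown from the line through 0 and [w]. *)
have [||||F [sF flatF cardF disF]] := @flat_extend n 1 r F0 (V :\ 0).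
- exact: adjoin_flat.
- by rewrite (@card_adjoin _ _ 0) ?cards1 ?set11 // add0r inE.
- apply/pred0P => x /=; rewrite in_setD1 inE !in_set1 addr2_eq0.
  by case: eqP => //= _; case: eqP => //= ->; rewrite (negPf wV).
- rewrite -[#|V :\ 0|.+1]add1n -[1%N]/(nat_of_bool true) -{1}zV -cardsD1 add1n.
  by apply: leq_ltn_trans (card_hidden_space ltrn) _; rewrite ltn_exp2l.
have F0F x : x \in F0 -> x \in F by apply: (subsetP sF).
have zF : 0 \in F by apply: F0F; rewrite !inE eqxx.
have wF : w \in F by apply: F0F; rewrite !inE addrr2 eqxx orbT.
pose S := [set x | t x \in F].
have tS : t @: S = F.
  apply/setP => x; apply/imsetP/idP => [[y /[!inE] yF ->] //|xF].
  by exists ((t^-1)%g x); rewrite ?inE permKV.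
have dS : dual_block r S.
  apply: (@flat_dual_block r n S ((t^-1)%g 0) ((t^-1)%g 0 + v)).
  - move=> x y z; rewrite !inE => xS yS zS.
    suff -> : t (x + y + z) = t x + t y + t z by apply: flatF.
    rewrite !tE !mulmxDr.
    by move: (A *m x) (A *m y) (A *m z) => ? ? ?; char2.
  - by rewrite -(card_imset _ (@perm_inj _ t)) tS cardF add1n.
  - by rewrite inE permKV.
  - by rewrite inE tE mulmxDr addrAC -tE permKV add0r.
  - rewrite -addr2_eq0 addrA addrr2 add0r; apply: contraNneq nzw => v0.
    by rewrite /w v0 mulmx0.
  by move/hidden_spaceP: vV => v0 i iJ; rewrite mxE (v0 i iJ) mxE addr0.
have := polar_aut_dual_block tP dS; rewrite tS => dF.
have [x [y [xF yF xy agr]]] := dual_block_agree ltrn dF.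
have := flatF _ _ _ zF xF yF; rewrite add0r => xyF.
move: disF => /pred0P/(_ (x + y)); rewrite /= xyF !inE addr2_eq0 xy /=.
by move/forall_inP; case=> i iJ; rewrite mxE (agr i iJ); apply/eqP; 
  case: (F2_cases (y i 0)) => ->; apply: val_inj.
Qed.

(** * The structure of the automorphism group *)

Section Splitting.
Variables r k : nat.
Local Notation m := r.+1.
Local Notation d := k.+1.
Local Notation n := (m + d)%N.
Implicit Types (x : 'cV['F_2]_n) (t : {perm 'cV['F_2]_n}).

(** The automorphism group of the polar code as a group of point permutations. *)
Definition polar_group : {group {perm 'cV['F_2]_n}} :=
  (position_perm_morphism n @*^-1 code_aut (polar_code r n))%G.

Lemma in_polar_group t :
  (t \in polar_group) = (position_perm t \in code_aut (polar_code r n)).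
Proof. by rewrite inE in_setT /= inE. Qed.

Lemma leading_lshift (i : 'I_m) : lshift d i \in leading_support r n.
Proof. by rewrite inE /= -ltnS. Qed.

Lemma leading_rshift (j : 'I_d) : rshift m j \notin leading_support r n.
Proof. by rewrite inE /= -ltnNge ltnS leq_addr. Qed.

(** The leading coordinates of a point come first and the hidden ones last, so an
    affine map preserves the hidden space when its matrix is block triangular. *)
Lemma triangular_polar_group t (P : 'M_m) p (Q : 'M_(d, m)) (R : 'M_d) q :
    (forall x, t x = col_mx (P *m usubmx x + p) (Q *m usubmx x + R *m dsubmx x + q)) ->
  t \in polar_group.
Proof.
move=> tE; rewrite in_polar_group.
apply: (@affine_polar_aut _ _ _ (block_mx P 0 Q R) (col_mx p q)).
- by rewrite ltnS leq_addr.
- move=> x; rewrite tE -{4}[x]vsubmxK mul_block_col mul0mx addr0 add_col_mx //.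
move=> i j; case: (split_ordP i) => i' -> // iJ; last by rewrite (negPf (leading_rshift _)) in iJ.
case: (split_ordP j) => j' ->; first by rewrite leading_lshift.
by rewrite block_mxEur mxE.
Qed.

Hypotheses (r2 : (2 <= r)%N) (k1 : (0 < k)%N).

Lemma polar_group_affine t : t \in polar_group ->
  exists (A : 'M['F_2]_n) b, A \in unitmx /\ forall x, t x = A *m x + b.
Proof.
rewrite in_polar_group => tP; apply: sum3_affine; apply: polar_aut_sum3 tP => //.
by rewrite addSn addnS !ltnS -addn1 leq_add2l.
Qed.

(** The off-diagonal block vanishes because hidden directions stay hidden. *)
Lemma polar_group_triangular t : t \in polar_group ->
  exists (P : 'M_m) p (Q : 'M_(d, m)) (R : 'M_d) q,
    [/\ P \in unitmx, R \in unitmx &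
      forall x, t x = col_mx (P *m usubmx x + p) (Q *m usubmx x + R *m dsubmx x + q)].
Proof.
move=> tG; have [A [b [uA tE]]] := polar_group_affine tG.
have A0 : ursubmx A = 0.
  apply/matrixP => i j; rewrite !mxE; move: tG; rewrite in_polar_group => tP.
  have ltrn : (r < n)%N by rewrite ltnS leq_addr.
  have : delta_mx (rshift m j) 0 \in hidden_space r n.
    apply/hidden_spaceP => l lJ; rewrite !mxE.
    by case: eqP lJ => // ->; rewrite (negPf (leading_rshift _)).
  move/(polar_aut_hidden ltrn tP tE)/hidden_spaceP/(_ _ (leading_lshift i)).
  by rewrite -colE !mxE.
have AE : A = block_mx (ulsubmx A) 0 (dlsubmx A) (drsubmx A) by rewrite -A0 submxK.
have : \det A != 0 by rewrite -unitfE.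
rewrite AE det_lblock mulf_eq0 negb_or -!unitfE => /andP[uP uR].
exists (ulsubmx A), (usubmx b), (dlsubmx A), (drsubmx A), (dsubmx b); split=> // x.
rewrite tE {1}AE -{1}[x]vsubmxK mul_block_col mul0mx addr0 -{1}[b]vsubmxK.
by rewrite add_col_mx.
Qed.

(** The normal factor translates the hidden coordinates by an affine function of
    the leading ones. Its coefficients form a [d * (m + 1)] matrix, applied to the
    leading coordinates extended by 1. *)
Definition shear_fun (w : 'rV['Z_2]_(d * (m + 1))) x : 'cV['F_2]_n :=
  col_mx (usubmx x) (dsubmx x + (vec_mx w : 'M['F_2]_(d, m + 1)) *m col_mx (usubmx x) 1%:M).

Lemma shear_funD w w' x : shear_fun w' (shear_fun w x) = shear_fun (w + w') x.
Proof.
rewrite /shear_fun col_mxKu col_mxKd; congr col_mx.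
by rewrite -addrA -mulmxDl [vec_mx (w + w')]linearD.
Qed.

Lemma shear_inj w : injective (shear_fun w).
Proof.
apply: (can_inj (g := shear_fun w)) => x; rewrite shear_funD.
by rewrite (addrr2 w) /shear_fun linear0 mul0mx addr0 vsubmxK.
Qed.

Definition shear w : {perm 'cV['F_2]_n} := perm (@shear_inj w).

Lemma shearM : {in setT &, {morph shear : w w' / (w * w')%g}}.
Proof. by move=> w w' _ _; apply/permP => x; rewrite permM !permE shear_funD. Qed.

Canonical shear_morphism := Morphism shearM.

Lemma mul_shear (M : 'M['F_2]_(d, m + 1)) (y : 'cV_m) :
  M *m col_mx y 1%:M = lsubmx M *m y + rsubmx M.
Proof. by rewrite -{1}[M]hsubmxK mul_row_col mulmx1. Qed.

Lemma shearE w x : let M := vec_mx w : 'M['F_2]_(d, m + 1) in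
  shear w x = col_mx (usubmx x) (dsubmx x + (lsubmx M *m usubmx x + rsubmx M)).
Proof. by rewrite permE /shear_fun mul_shear. Qed.

Lemma injm_shear : 'injm shear_morphism.
Proof.
apply/injmP => w w' _ _ /permP eq_ww'; apply: (can_inj vec_mxK).
have {}eq_ww' (y : 'cV['F_2]_m) :
    lsubmx (vec_mx w : 'M['F_2]_(d, m + 1)) *m y + rsubmx (vec_mx w)
    = lsubmx (vec_mx w') *m y + rsubmx (vec_mx w').
  have := eq_ww' (col_mx y 0); rewrite !shearE /= col_mxKu col_mxKd !add0r.
  by case/eq_col_mx.
have eqr : rsubmx (vec_mx w : 'M['F_2]_(d, m + 1)) = rsubmx (vec_mx w').
  by have := eq_ww' 0; rewrite !mulmx0 !add0r.
have eql : lsubmx (vec_mx w : 'M['F_2]_(d, m + 1)) = lsubmx (vec_mx w').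
  apply/matrixP => i j; have := eq_ww' (delta_mx j 0); rewrite eqr => /addIr.
  by rewrite -!colE => /matrixP/(_ i 0); rewrite !mxE.
by rewrite -[LHS]hsubmxK -[RHS]hsubmxK; congr row_mx.
Qed.

(** The complement acts on leading and hidden coordinates separately; the
    transpose turns the matrix product into the composition order of
    permutations. *)
Definition product_fun (u : {perm 'cV['F_2]_m} * {'GL_d['F_2]}) x : 'cV['F_2]_n :=
  col_mx (u.1 (usubmx x)) ((GLval u.2)^T *m dsubmx x).

Lemma product_funM u u' x : product_fun u' (product_fun u x) = product_fun (u * u')%g x.
Proof.
rewrite /product_fun col_mxKu col_mxKd permM; congr col_mx.
by rewrite mulmxA -trmx_mul.
Qed.

Lemma product_inj u : injective (product_fun u).
Proof.
apply: (can_inj (g := product_fun (u^-1)%g)) => x; rewrite product_funM mulgV.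
by rewrite /product_fun perm1 /= trmx1 mul1mx vsubmxK.
Qed.

Definition product_perm u : {perm 'cV['F_2]_n} := perm (@product_inj u).

Lemma product_permM : {in setT &, {morph product_perm : u u' / (u * u')%g}}.
Proof. by move=> u u' _ _; apply/permP => x; rewrite permM !permE product_funM. Qed.

Canonical product_morphism := Morphism product_permM.

Lemma injm_product : 'injm product_morphism.
Proof.
apply/injmP => -[s g] [s' g'] _ _ /permP eq_uu'.
have {}eq_uu' (y : 'cV_m) (z : 'cV_d) : s y = s' y /\ (GLval g)^T *m z = (GLval g')^T *m z.
  have := eq_uu' (col_mx y z); rewrite !permE /product_fun /= col_mxKu col_mxKd.
  by case/eq_col_mx.
congr pair; first by apply/permP => y; have [] := eq_uu' y 0.
apply/val_inj/trmx_inj/matrixP => i j.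
have [_] := eq_uu' 0 (delta_mx j 0).
by rewrite -!colE => /matrixP/(_ i 0); rewrite !mxE.
Qed.

Local Notation shears := (shear_morphism @* [set: 'rV['Z_2]_(d * (m + 1))])%G.
Local Notation products :=
  (product_morphism @* setX_group (AGL m) (GLgroup_group d 'F_2))%G.

Lemma mem_AGL (s : {perm 'cV['F_2]_m}) : s \in AGL m ->
  exists P p, P \in unitmx /\ forall y, s y = P *m y + p.
Proof.
rewrite inE => /existsP[P /existsP[p /andP[uP /forallP sE]]].
by exists P, p; split=> // y; apply/eqP.
Qed.

Lemma shears_sub : shears \subset polar_group.
Proof.
apply/subsetP => _ /morphimP[w _ _ ->]; set M := vec_mx w : 'M['F_2]_(d, m + 1).
apply: (@triangular_polar_group _ 1%:M 0 (lsubmx M) 1%:M (rsubmx M)) => x.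
rewrite /= shearE !mul1mx addr0; congr col_mx.
by rewrite addrA [_ + dsubmx x]addrC.
Qed.

Lemma products_sub : products \subset polar_group.
Proof.
apply/subsetP => _ /morphimP[[s g] _ /setXP[/mem_AGL[P [p [uP sE]]] _] ->].
apply: (@triangular_polar_group _ P p 0 (GLval g)^T 0) => x.
by rewrite /= permE /product_fun /= sE mul0mx add0r addr0.
Qed.

(** Conjugation turns the coefficients [M] of a shear into those of the affine
    function [y |-> G (M_l (s^-1 y) + M_r)]. *)
Lemma products_norm_shears : products \subset 'N(shears).
Proof.
apply/subsetP => _ /morphimP[[s g] _ /setXP[/mem_AGL[P [p [uP sE]]] _] ->].
rewrite inE; apply/subsetP => _ /imsetP[_ /morphimP[w _ _ ->] ->].
set M := vec_mx w : 'M['F_2]_(d, m + 1); set G := (GLval g)^T.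
pose L := G *m lsubmx M *m invmx P.
pose w' : 'rV['Z_2]_(d * (m + 1)) := mxvec (row_mx L (G *m rsubmx M + L *m p)).
suff -> : (shear w ^ product_perm (s, g))%g = shear w' by apply: mem_morphim; rewrite inE.
apply: (canLR (mulKg _)); apply/permP => x; rewrite !permM !shearE.
rewrite !permE /product_fun /= !col_mxKu !col_mxKd; congr col_mx.
rewrite mxvecK row_mxKl row_mxKr -/M -/G !mulmxDr sE mulmxDr; congr (_ + _).
have -> : L *m (P *m usubmx x) = G *m (lsubmx M *m usubmx x).
  by rewrite /L !mulmxA mulmxKV.
move: (G *m (lsubmx M *m usubmx x)) (G *m rsubmx M) (L *m p) => a b c.
by char2.
Qed.

Lemma shears_products_TI : shears :&: products = 1%g.
Proof.
apply/trivgP/subsetP => _ /setIP[/morphimP[w _ _ ->] /morphimP[[s g] _ _ /permP wE]].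
set M := vec_mx w : 'M['F_2]_(d, m + 1).
rewrite inE; apply/eqP/permP => x; rewrite perm1 /= shearE -/M.
have := wE (col_mx (usubmx x) 0); rewrite /= shearE permE /product_fun /=.
rewrite !col_mxKu !col_mxKd mulmx0 add0r => /eq_col_mx[_ ->].
by rewrite addr0 vsubmxK.
Qed.

(** The shear has to produce the mixed terms before [R] acts on the hidden
    coordinates, so its coefficients are those of [t] multiplied by [invmx R]. *)
Lemma shears_products : (shears * products)%g = polar_group.
Proof.
apply/eqP; rewrite eqEsubset mul_subG ?shears_sub ?products_sub //=.
apply/subsetP => t /polar_group_triangular[P [p [Q [R [q [uP uR tE]]]]]].
have sP_inj : injective (fun y : 'cV['F_2]_m => P *m y + p).
  by move=> y y' /addIr/(congr1 (mulmx (invmx P))); rewrite !mulKmx.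
pose s := perm sP_inj.
have sA : s \in AGL m.
  rewrite inE; apply/existsP; exists P; apply/existsP; exists p; rewrite uP /=.
  by apply/forallP => y; rewrite permE.
have [g gE] : exists g : {'GL_d['F_2]}, GLval g = R^T.
  have uRT : R^T \is a GRing.unit by rewrite -[_ \is a _]/(R^T \in unitmx) unitmx_tr.
  by exists (FinRing.Unit uRT).
pose w : 'rV['Z_2]_(d * (m + 1)) := mxvec (row_mx (invmx R *m Q) (invmx R *m q)).
have -> : t = (shear w * product_perm (s, g))%g.
  apply/permP => x; rewrite permM shearE permE /product_fun /= col_mxKu col_mxKd.
  rewrite mxvecK row_mxKl row_mxKr permE gE trmxK tE !mulmxDr !mulmxA mulmxV // !mul1mx.
  by congr col_mx; rewrite -addrA addrCA.
apply: mem_mulg; first exact: (mem_morphim shear_morphism (in_setT w) (in_setT w)).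
apply: (mem_morphim product_morphism (in_setT (s, g))).
by apply/setXP; split; last exact: in_setT.
Qed.

Lemma polar_aut_split :
  isog_split_extension (code_aut (polar_code r n))
    [set: 'rV['Z_2]_(d * (m + 1))] (setX_group (AGL m) (GLgroup_group d 'F_2)).
Proof.
have f_inj := injm_position_perm n; set f := position_perm_morphism n in f_inj.
exists (f @* shears)%G, (f @* products)%G; split.
- have sd : shears ><| products = polar_group.
    by rewrite sdprodE ?shears_products ?products_norm_shears ?shears_products_TI.
  rewrite (injm_sdprod _ f_inj sd) ?subsetT //.
  apply: morphpreK; apply/subsetP => t _.
  by rewrite -[t]point_permK; apply: (mem_morphim f); rewrite inE.
- rewrite isog_sym; apply: isog_trans (sub_isog _ injm_shear) (sub_isog _ f_inj);
  exact: subsetT.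
rewrite isog_sym; apply: isog_trans (sub_isog _ injm_product) (sub_isog _ f_inj);
exact: subsetT.
Qed.

End Splitting.

Theorem theorem4p1 (r n : nat) (hr : (2 <= r)%N) (hrn : (r <= n - 3)%N) :
  let m := r.+1 in
  [/\ code_aut (polar_code r n) \subset code_aut (reed_muller_code r n),
      forall s : 'S_(2 ^ n),
        s \in code_aut (polar_code r n) -> affine_position_perm s
    & isog_split_extension
        (code_aut (polar_code r n))
        [set: 'rV['Z_2]_((n - m) * (m + 1))]
        (setX_group (AGL m) (GLgroup_group (n - m) 'F_2))].
Proof.
cbv zeta.
have n3 : (3 < n)%N by rewrite -subn_gt0 (leq_trans _ hrn) // ltnW.
have rn : (r.+2 < n)%N by move: hrn; rewrite leq_subRL // ltnW.
have affine t : position_perm t \in code_aut (polar_code r n) ->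
    exists (A : 'M['F_2]_n) b, A \in unitmx /\ forall x, t x = A *m x + b.
  by move=> tP; apply: sum3_affine; apply: polar_aut_sum3 tP.
split.
- apply/subsetP => s; rewrite -[s]point_permK => /affine[A [b [_ tE]]].
  exact: affine_reed_muller_aut tE.
- move=> s; rewrite -[s]point_permK => /affine[A [b [uA tE]]].
  by exists A, b; split=> // j; rewrite position_permE tE.
have nE : n = (r.+1 + (n - r.+1))%N by rewrite subnKC // ltnW // ltnW.
have k1 : (1 < n - r.+1)%N by rewrite ltn_subRL addn1.
move: {hrn n3 rn affine} nE k1; move: (n - r.+1)%N => [|k] // -> k1.
exact: polar_aut_split.
Qed.
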